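(* Consider the Bruck–Bose representation of $\mathrm{PG}(2,q^3)$ in $\mathrm{PG}(6,q)$ with respect to a line at infinity $\ell_\infty$ of Type I. Then the set of all affine I-points and affine II-points of $\mathrm{PG}(6,q)$ is precisely the set of affine points of a quadric of $\mathrm{PG}(6,q)$ which is degenerate, with vertex the plane $\pi_{\mathrm{fix}}$ and base a non-singular hyperbolic quadric of a 3-space disjoint from $\pi_{\mathrm{fix}}$.
   Context: Let $q>2$ be a prime power. Let $\phi$ be a collineation of $\mathrm{PG}(2,q^3)$ of order 3 fixing pointwise an $\mathbb F_q$-subplane $\mathcal P_{2,q}$. A point $\bar P$ of $\mathrm{PG}(2,q^3)$ has Type I if it lies in $\mathcal P_{2,q}$, Type II if $\bar P,\bar P^\phi,\bar P^{\phi^2}$ are distinct and collinear, and Type III if they are non-collinear; a line has Type I if it meets $\mathcal P_{2,q}$ in $q+1$ points. Bruck–Bose representation: fix a basis $1,\tau,\tau^2$ of $\mathbb F_{q^3}$ over $\mathbb F_q$ and let $\theta(x_0+x_1\tau+x_2\tau^2)=(x_0,x_1,x_2)$. Choose coordinates so that $\ell_\infty$ is $z=0$. The affine point $\bar P=(x,y,1)$ of $\mathrm{PG}(2,q^3)$ corresponds to the point $[P]=(\theta(x),\theta(y),1)$ of $\mathrm{PG}(6,q)$, not in the hyperplane $\Sigma_\infty$ (last coordinate $0$); affine points of $\mathrm{PG}(6,q)$ are those not in $\Sigma_\infty$. An affine point $[P]$ is called an X-point ($X\in\{$I,II,III$\}$) if $\bar P$ has Type X. $\pi_{\mathrm{fix}}$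 denotes the plane of $\mathrm{PG}(6,q)$ representing $\mathcal P_{2,q}$, i.e. the plane whose affine points are exactly the points $[P]$ with $\bar P$ an affine point of $\mathcal P_{2,q}$. *)

(* Defs.v *)
From HB Require Import structures.
From mathcomp Require Import all_boot all_order all_algebra all_field.
Set Implicit Arguments.
Unset Strict Implicit.
Unset Printing Implicit Defensive.
Import GRing.Theory.
Local Open Scope ring_scope.

(* A k-dimensional projective subspace of PG(n, K) is a (k+1)-dimensional     *)
(* linear subspace of K^(n+1).                                                *)
Notation flat K n k := {U : {vspace 'rV[K]_n.+1} | \dim U == k.+1}.
Notation point K n := (flat K n 0).
Notation line K n := (flat K n 1).
Notation plane K n := (flat K n 2).
Notation solid K n := (flat K n 3).

Definition on (K : fieldType) (n j k : nat) (P : flat K n j) (U : flat K n k)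
  : Prop := (val P <= val U)%VS.

Lemma dim_point (K : fieldType) (n : nat) (v : 'rV[K]_n.+1) :
  v != 0 -> \dim <[v]>%VS == 1%N.
Proof. by move=> nz; rewrite dim_vline nz. Qed.

Definition mkpoint (K : fieldType) (n : nat) (v : 'rV[K]_n.+1) (nz : v != 0)
  : point K n := exist _ <[v]>%VS (dim_point nz).

Definition hyper_inf_vs (K : fieldType) (n : nat) : {vspace 'rV[K]_n.+2} :=
  lker (linfun (mulmxr (delta_mx ord_max 0 : 'cV[K]_n.+2)
                : 'rV[K]_n.+2 -> 'rV[K]_1)).

Lemma mem_hyper_inf (K : fieldType) (n : nat) (v : 'rV[K]_n.+2) :
  (v \in hyper_inf_vs K n) = (v 0 ord_max == 0).
Proof.
rewrite memv_ker lfunE /= -colE; apply/eqP/eqP => [/rowP/(_ 0)|v0].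
  by rewrite !mxE.
by apply/rowP => i; rewrite !mxE.
Qed.

Lemma dim_hyper_inf (K : fieldType) (n : nat) :
  \dim (hyper_inf_vs K n) == n.+1.
Proof.
have := limg_ker_dim (linfun (mulmxr (delta_mx ord_max 0 : 'cV[K]_n.+2)
                : 'rV[K]_n.+2 -> 'rV[K]_1)) fullv.
rewrite capfv -/(hyper_inf_vs K n) dimvf /dim /= mul1n.
set f := linfun _; suff -> : limg f = fullv.
  by rewrite dimvf /dim /= mul1n addn1 => -[->].
apply/eqP; rewrite eqEsubv subvf /=; apply/subvP => w _.
have -> : w = f (w 0 0 *: delta_mx 0 ord_max).
  rewrite lfunE /= -scalemxAl mul_delta_mx; apply/rowP => i.
  by rewrite !ord1 !mxE eqxx mulr1.
exact: memv_img (memvf _).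
Qed.

Definition hyper_inf (K : fieldType) (n : nat) : flat K n.+1 n :=
  exist _ (hyper_inf_vs K n) (dim_hyper_inf K n).

Definition affine (K : fieldType) (n : nat) (P : point K n.+1) : Prop :=
  ~ on P (hyper_inf K n).

Definition collinear (K : fieldType) (n : nat) (P Q R : point K n) : Prop :=
  exists l : line K n, [/\ on P l, on Q l & on R l].

Definition collineation (K : fieldType) (n : nat)
    (phi : point K n -> point K n) : Prop :=
  bijective phi /\
  forall l : line K n, exists m : line K n, forall P, on P l <-> on (phi P) m.

Definition order3 (T : Type) (f : T -> T) : Prop :=
  (forall x, f (f (f x)) = x) /\ ~ (forall x, f x = x).

(* An F-subplane of PG(2, L): the image of PG(2, F) under a homography of     *)
(* PG(2, L).                                                                  *)
Definition subplane (F : fieldType) (L : fieldExtType F)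
    (B : point L 2 -> Prop) : Prop :=
  exists2 M : 'M[L]_3, M \in unitmx &
    forall P, B P <->
      exists2 w : 'rV[F]_3, w != 0 & val P = <[map_mx (in_alg L) w *m M]>%VS.

Definition type_I (K : fieldType) (B : point K 2 -> Prop) (P : point K 2)
  : Prop := B P.

Definition type_II (K : fieldType) (phi : point K 2 -> point K 2)
    (P : point K 2) : Prop :=
  [/\ P <> phi P, P <> phi (phi P), phi P <> phi (phi P)
    & collinear P (phi P) (phi (phi P))].

Definition line_type_I (F : finFieldType) (L : fieldExtType F)
    (B : point L 2 -> Prop) (l : line L 2) : Prop :=
  exists s : seq (point L 2),
    [/\ uniq s, size s = #|F|.+1 & forall P, P \in s <-> B P /\ on P l].

Definition theta (F : fieldType) (L : fieldExtType F) (tau x : L) : 'rV[F]_3 :=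
  \row_i coord [tuple 1; tau; tau ^+ 2] i x.

Definition aff_vec (K : fieldType) (n : nat) (v : 'rV[K]_n) : 'rV[K]_(n + 1) :=
  row_mx v 1%:M.

Lemma aff_vec_neq0 (K : fieldType) (n : nat) (v : 'rV[K]_n) : aff_vec v != 0.
Proof.
by rewrite /aff_vec row_mx_eq0 negb_and -scalemx1 scale1r oner_eq0 orbT.
Qed.

Definition aff_point (K : fieldType) (x y : K) : point K 2 :=
  mkpoint (aff_vec_neq0 (row_mx x%:M y%:M : 'rV[K]_(1 + 1))).

Definition bb_point (F : fieldType) (L : fieldExtType F) (tau x y : L)
  : point F 6 :=
  mkpoint (aff_vec_neq0 (row_mx (theta tau x) (theta tau y))).

Definition bb_image (F : fieldType) (L : fieldExtType F) (tau : L)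
    (T : point L 2 -> Prop) (R : point F 6) : Prop :=
  exists x y : L, R = bb_point tau x y /\ T (aff_point x y).

Definition represents_subplane (F : fieldType) (L : fieldExtType F) (tau : L)
    (B : point L 2 -> Prop) (pi : plane F 6) : Prop :=
  forall R : point F 6, (affine R /\ on R pi) <-> bb_image tau B R.

(* Quadrics. The matrix A need not be symmetric, so that every quadratic form *)
(* is covered in every characteristic, 2 included.                            *)

Definition qform (K : fieldType) (n : nat) (A : 'M[K]_n) (v : 'rV[K]_n) : K :=
  (v *m A *m v^T) 0 0.

Definition polar (K : fieldType) (n : nat) (A : 'M[K]_n) (u v : 'rV[K]_n) : K :=
  qform A (u + v) - qform A u - qform A v.

Definition quadric (K : fieldType) (n : nat) (A : 'M[K]_n.+1) (P : point K n)
  : Prop := forall v, v \in val P -> qform A v = 0.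

(* P is a singular point of the quadric that A cuts out in the subspace W.    *)
Definition singular_point (K : fieldType) (n : nat) (A : 'M[K]_n.+1)
    (W : {vspace 'rV[K]_n.+1}) (P : point K n) : Prop :=
  [/\ (val P <= W)%VS, quadric A P
    & forall u w, u \in val P -> w \in W -> polar A u w = 0].

Definition degenerate (K : fieldType) (n : nat) (A : 'M[K]_n.+1) : Prop :=
  exists P : point K n, singular_point A fullv P.

Definition has_vertex (K : fieldType) (n k : nat) (A : 'M[K]_n.+1)
    (V : flat K n k) : Prop :=
  forall P : point K n, singular_point A fullv P <-> on P V.

(* The canonical form of a hyperbolic quadric of PG(3, K) is x0x1 + x2x3 = 0. *)
Definition nonsingular_hyperbolic (K : fieldType) (n : nat) (A : 'M[K]_n.+1)
    (S : solid K n) : Prop :=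
  (forall P : point K n, ~ singular_point A (val S) P) /\
  exists2 e : 4.-tuple 'rV[K]_n.+1, basis_of (val S) e &
    forall a b c d : K,
      qform A (a *: e`_0 + b *: e`_1 + c *: e`_2 + d *: e`_3) = a * b + c * d.

Definition cone (K : fieldType) (n k : nat) (V : flat K n k)
    (X : point K n -> Prop) (P : point K n) : Prop :=
  exists Q R : point K n, [/\ on Q V, X R & (val P <= val Q + val R)%VS].

Definition disjoint_flats (K : fieldType) (n j k : nat) (U : flat K n j)
    (V : flat K n k) : Prop := forall P : point K n, ~ (on P U /\ on P V).

(* Main.v *)
Require Import Defs.
From HB Require Import structures.
From mathcomp Require Import all_boot all_order all_algebra all_field.
From mathcomp Require Import ring.
Set Implicit Arguments.
Unset Strict Implicit.
Unset Printing Implicit Defensive.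
Import GRing.Theory.
Local Open Scope ring_scope.

(** The fixed points and fixed lines of [phi] are closed under joining and
    meeting. In a frame adapted to the subplane [B], the [x] for which (1, x, 0)
    is fixed therefore form an intermediate ring between [F] and [L]; the
    degree 3 is prime and [phi] is not the identity, so this ring is [F]. Hence
    the fixed points are exactly the points of [B], the fixed lines are the
    lines of [B], and a point has Type I or II iff it lies on a line of [B],
    i.e. iff its coordinates in the frame are linearly dependent over [F].

    As the line at infinity is a line of [B], the frame can be chosen so that
    affine points have coordinates (1, a, b). Writing
    a = a0 + a1 tau + a2 tau^2 and likewise b, the dependence of 1, a, b over
    [F] reads a1 b2 - a2 b1 = 0. This is a quadratic form in the coordinates of
    PG(6, F), hyperbolic on the 3-space a0 = b0 = t = 0, and with radical the
    plane a1 = a2 = b1 = b2 = 0, which represents [B]. *)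

(** * Points, flats and quadratic forms *)

Lemma vlineZ (K : fieldType) (V : vectType K) (k : K) (v : V) :
  k != 0 -> <[k *: v]>%VS = <[v]>%VS.
Proof.
move=> nzk; apply/eqP; rewrite eqEsubv -!memvE memvZ ?memv_line //=.
by apply/vlineP; exists k^-1; rewrite scalerA mulVf ?scale1r.
Qed.

Lemma pointP (K : fieldType) (n : nat) (P : point K n) :
  exists2 v, v != 0 & val P = <[v]>%VS.
Proof.
case: P => U /= dU; exists (vpick U).
  by rewrite vpick0 -dimv_eq0 (eqP dU).
apply/esym/eqP; rewrite eqEdim -memvE memv_pick /= (eqP dU) dim_vline.
by rewrite vpick0 -dimv_eq0 (eqP dU).
Qed.

Lemma qformZ (K : fieldType) (n : nat) (A : 'M[K]_n) (c : K) v :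
  qform A (c *: v) = c ^+ 2 * qform A v.
Proof.
by rewrite /qform linearZ /= -!scalemxAl -scalemxAr scalerA mxE.
Qed.

Lemma quadric_vline (K : fieldType) (n : nat) (A : 'M[K]_n.+1) (P : point K n)
    (v : 'rV[K]_n.+1) : val P = <[v]>%VS -> quadric A P <-> qform A v = 0.
Proof.
move=> Pv; split=> [|Av w].
  by apply; rewrite Pv memv_line.
by rewrite Pv => /vlineP[c ->]; rewrite qformZ Av mulr0.
Qed.

(** A flat with an affine point is spanned by its affine vectors: if [a] is affine and [v] is at
    infinity, then [v] is the difference of the affine vectors [v + a] and [a]. This is what makes
    the plane representing the subplane unique. *)
Lemma flat_eq_affine (K : fieldType) (n k : nat) (U V : flat K n.+1 k) :
    (exists P : point K n.+1, affine P /\ on P U) ->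
    (forall P : point K n.+1, affine P /\ on P U <-> affine P /\ on P V) ->
  U = V.
Proof.
move=> [P [affP PU]] UV; apply/val_inj/eqP.
rewrite eqEdim (eqP (valP U)) (eqP (valP V)) leqnn andbT.
have [a nz_a Pa] := pointP P.
have affE (Q : point K n.+1) v : val Q = <[v]>%VS ->
    affine Q <-> v 0 ord_max <> 0.
  move=> Qv; rewrite /affine /on /= Qv -memvE mem_hyper_inf.
  by split=> h /eqP; apply: h; apply/eqP.
have onE (j : nat) (Q : point K n.+1) (W : flat K n.+1 j) v :
    val Q = <[v]>%VS -> on Q W <-> v \in val W.
  by move=> Qv; rewrite /on Qv memvE.
have step v : v \in val U -> v 0 ord_max <> 0 -> v \in val V.
  move=> vU v_aff; have nz_v : v != 0.
    by apply/eqP => v0; rewrite v0 mxE in v_aff.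
  have /UV[_] : affine (mkpoint nz_v) /\ on (mkpoint nz_v) U.
    split; first exact/(affE (mkpoint nz_v) v erefl).
    exact/(onE _ (mkpoint nz_v) _ v erefl).
  by move/(onE _ (mkpoint nz_v) _ v erefl).
have aU : a \in val U by have /(onE _ _ _ _ Pa) := PU.
have a_aff : a 0 ord_max <> 0 by have /(affE _ _ Pa) := affP.
apply/subvP => v vU; have [v0|/eqP/step] := eqVneq (v 0 ord_max) 0; last exact.
rewrite -(addrK a v); apply: memvB; last exact: step.
by apply: step; [exact: memvD | rewrite mxE v0 add0r].
Qed.

(** * A cone over a hyperbolic quadric *)

Local Notation i0 := (@Ordinal 7 0 isT).
Local Notation i1 := (@Ordinal 7 1 isT).
Local Notation i2 := (@Ordinal 7 2 isT).
Local Notation i3 := (@Ordinal 7 3 isT).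
Local Notation i4 := (@Ordinal 7 4 isT).
Local Notation i5 := (@Ordinal 7 5 isT).
Local Notation i6 := (@Ordinal 7 6 isT).

Section HyperbolicCone.

Variables (K : fieldType) (T : 'M[K]_7).
Hypothesis unitT : T \in unitmx.

Local Notation y v i := (((v : 'rV[K]_7) *m T) 0 i).
Local Notation e i := (row i (invmx T)).

(* The form y0 y1 + y2 y3 in the coordinates y = v T. *)
Definition cone_mx : 'M[K]_7 :=
  T *m (delta_mx i0 i1 + delta_mx i2 i3) *m T^T.

Lemma cone_coord_basis i j : y (e i) j = (i == j)%:R.
Proof. by rewrite -row_mul mulVmx // !mxE. Qed.

Lemma cone_coordD u v i : y (u + v) i = y u i + y v i.
Proof. by rewrite mulmxDl mxE. Qed.

Lemma cone_coordZ c v i : y (c *: v) i = c * y v i.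
Proof. by rewrite -scalemxAl mxE. Qed.

Lemma cone_coord0 i : y 0 i = 0.
Proof. by rewrite mul0mx mxE. Qed.

Lemma cone_coord_inj u v : (forall i, y u i = y v i) -> u = v.
Proof.
by move=> uv; apply: (can_inj (mulmxK unitT)); apply/rowP => i; apply: uv.
Qed.

Lemma ord7_ind (P : 'I_7 -> Prop) :
  P i0 -> P i1 -> P i2 -> P i3 -> P i4 -> P i5 -> P i6 -> forall i, P i.
Proof.
move=> ? ? ? ? ? ? ?; case=> [[|[|[|[|[|[|[|//]]]]]]] lt_i];
by rewrite (bool_irrelevance lt_i isT).
Qed.

Lemma qform_cone_mx v : qform cone_mx v =
  y v i0 * y v i1 + y v i2 * y v i3.
Proof.
rewrite /qform /cone_mx !mulmxA -[_ *m T^T *m _]mulmxA -trmx_mul.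
rewrite mulmxDr mulmxDl mxE; congr (_ + _);
(* A matrix unit factors as a column times a row, which splits its term into a product of two
   coordinates. *)
by rewrite -(mul_delta_mx (0 : 'I_1)) !mulmxA -colE -mulmxA -rowE mxE big_ord1
           !mxE.
Qed.

Lemma polar_cone_mx u v : polar cone_mx u v =
  y u i0 * y v i1 + y u i1 * y v i0 + y u i2 * y v i3 + y u i3 * y v i2.
Proof. by rewrite /polar !qform_cone_mx !cone_coordD; ring. Qed.

Local Notation eS := [tuple e i0; e i1; e i2; e i3].
Local Notation eV := [tuple e i4; e i5; e i6].

(** Seven vectors that span a space of dimension 7 are free. *)
Lemma cone_basis_free : free (eS ++ eV).
Proof.
rewrite /free (_ : <<_>>%VS = fullv) ?dimvf ?mul1n //.
apply/eqP; rewrite eqEsubv subvf; apply/subvP => v _.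
have -> : v = y v i0 *: e i0 + y v i1 *: e i1 + y v i2 *: e i2 + y v i3 *: e i3
    + y v i4 *: e i4 + y v i5 *: e i5 + y v i6 *: e i6.
  apply: cone_coord_inj; apply: ord7_ind;
  by rewrite !cone_coordD !cone_coordZ !cone_coord_basis
             ?(mulr0, mulr1, addr0, add0r).
by rewrite !memvD ?memvZ ?memv_span // !inE eqxx ?orbT.
Qed.

Lemma mem_cone_base v :
  (v \in <<eS>>%VS) = [&& y v i4 == 0, y v i5 == 0 & y v i6 == 0].
Proof.
apply/idP/and3P => [/coord_span -> | [/eqP v4 /eqP v5 /eqP v6]].
  by rewrite !big_ord_recl big_ord0 /= !cone_coordD !cone_coordZ !cone_coord0
             !cone_coord_basis !mulr0 !addr0 eqxx.
have -> : v = y v i0 *: e i0 + y v i1 *: e i1 + y v i2 *: e i2 + y v i3 *: e i3.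
  apply: cone_coord_inj; apply: ord7_ind;
  by rewrite !cone_coordD !cone_coordZ !cone_coord_basis
             ?(mulr0, mulr1, addr0, add0r).
by rewrite !memvD ?memvZ ?memv_span // !inE eqxx ?orbT.
Qed.

Lemma mem_cone_vertex v : (v \in <<eV>>%VS) =
  [&& y v i0 == 0, y v i1 == 0, y v i2 == 0 & y v i3 == 0].
Proof.
apply/idP/and4P => [/coord_span -> | [/eqP v0 /eqP v1 /eqP v2 /eqP v3]].
  by rewrite !big_ord_recl big_ord0 /= !cone_coordD !cone_coordZ !cone_coord0
             !cone_coord_basis !mulr0 !addr0 eqxx.
have -> : v = y v i4 *: e i4 + y v i5 *: e i5 + y v i6 *: e i6.
  apply: cone_coord_inj; apply: ord7_ind;
  by rewrite !cone_coordD !cone_coordZ !cone_coord_basis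
             ?(mulr0, mulr1, addr0, add0r).
by rewrite !memvD ?memvZ ?memv_span // !inE eqxx ?orbT.
Qed.

Lemma dim_cone_base : \dim <<eS>>%VS == 4%N.
Proof. by move/catl_free: cone_basis_free; rewrite /free. Qed.

Lemma dim_cone_vertex : \dim <<eV>>%VS == 3%N.
Proof. by move/catr_free: cone_basis_free; rewrite /free. Qed.

Definition cone_base : solid K 6 := exist _ <<eS>>%VS dim_cone_base.
Definition cone_vertex : plane K 6 := exist _ <<eV>>%VS dim_cone_vertex.

Lemma cone_basis_neq0 i : e i != 0.
Proof.
apply/eqP => /(congr1 (fun v => y v i))/eqP.
by rewrite cone_coord_basis cone_coord0 eqxx oner_eq0.
Qed.

(** Polarising [v] against [e i0], ..., [e i3] returns its coordinates 1, 0, 3, 2 in every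
    characteristic; the form and its polar do not involve the other three. *)
Lemma cone_has_vertex : has_vertex cone_mx cone_vertex.
Proof.
move=> P; have [v nz_v Pv] := pointP P.
rewrite /on Pv -memvE /= mem_cone_vertex; split=> [[_ _ sing]|].
  have sv i : polar cone_mx v (e i) = 0.
    by apply: sing; rewrite ?Pv ?memv_line ?memvf.
  move: (sv i0) (sv i1) (sv i2) (sv i3).
  rewrite !polar_cone_mx !cone_coord_basis /=.
  by rewrite !(mulr0, mulr1, addr0, add0r) => -> -> -> ->; rewrite eqxx.
case/and4P=> /eqP v0 /eqP v1 /eqP v2 /eqP v3.
split; first exact: subvf.
  by apply/(quadric_vline _ Pv); rewrite qform_cone_mx v0 v2 !mul0r addr0.
move=> u w; rewrite Pv => /vlineP[c ->] _.
by rewrite polar_cone_mx !cone_coordZ v0 v1 v2 v3 !(mulr0, mul0r, addr0).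
Qed.

Lemma cone_degenerate : degenerate cone_mx.
Proof.
exists (mkpoint (cone_basis_neq0 i4)); apply/cone_has_vertex.
by rewrite /on /= -memvE memv_span // !inE eqxx.
Qed.

Lemma cone_disjoint : disjoint_flats cone_base cone_vertex.
Proof.
move=> P; have [v nz_v Pv] := pointP P.
rewrite /on Pv -!memvE /= mem_cone_base mem_cone_vertex => -[].
case/and3P=> /eqP v4 /eqP v5 /eqP v6 /and4P[/eqP v0 /eqP v1 /eqP v2 /eqP v3].
by case/eqP: nz_v; apply: cone_coord_inj; apply: ord7_ind; rewrite cone_coord0.
Qed.

Lemma cone_base_hyperbolic : nonsingular_hyperbolic cone_mx cone_base.
Proof.
split; last first.
  exists eS.
    by rewrite basisEfree subvv (catl_free cone_basis_free) (eqP dim_cone_base).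
  move=> a b c d.
  rewrite qform_cone_mx !cone_coordD !cone_coordZ !cone_coord_basis /=.
  by rewrite !(mulr0, mulr1, addr0, add0r).
move=> P; have [v nz_v Pv] := pointP P.
case; rewrite Pv -memvE /= mem_cone_base.
case/and3P=> /eqP v4 /eqP v5 /eqP v6 _ sing.
(* The four basis vectors of the base detect the first four coordinates of a singular vector; the
   other three vanish on the base. *)
have sv i : e i \in eS -> polar cone_mx v (e i) = 0.
  by move=> ie; apply: sing; rewrite ?memv_line ?memv_span.
move: (sv i0) (sv i1) (sv i2) (sv i3).
rewrite !polar_cone_mx !cone_coord_basis /=.
rewrite !(mulr0, mulr1, addr0, add0r) !inE !eqxx ?orbT => v1 v0 v3 v2.
case/eqP: nz_v; apply: cone_coord_inj; apply: ord7_ind;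
by rewrite cone_coord0 ?(v0, v1, v2, v3, v4, v5, v6).
Qed.

(** Each vector splits into a vertex part [u] and a base part [s], and the form takes the same value
    at the vector as at [s]. *)
Lemma quadric_coneP (R : point K 6) : quadric cone_mx R <->
  cone cone_vertex (fun T => on T cone_base /\ quadric cone_mx T) R.
Proof.
have [v nz_v Rv] := pointP R; split=> [/(quadric_vline _ Rv)|]; last first.
  case=> Q [S [onQ [onS /[swap]]]].
  have [s _ Ss] := pointP S; have [u _ Qu] := pointP Q.
  move: onQ onS; rewrite /on Ss Qu Rv -!memvE /= mem_cone_vertex.
  case/and4P=> /eqP u0 /eqP u1 /eqP u2 /eqP u3 _.
  case/memv_addP=> _ /vlineP[a ->] [_ /vlineP[b ->] def_v].
  move/(quadric_vline _ Ss) => qs; apply/(quadric_vline _ Rv).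
  rewrite -(mulr0 (b ^+ 2)) -[in RHS]qs !qform_cone_mx def_v.
  by rewrite !cone_coordD !cone_coordZ u0 u1 u2 u3; ring.
rewrite qform_cone_mx => qv.
pose s := y v i0 *: e i0 + y v i1 *: e i1 + y v i2 *: e i2 + y v i3 *: e i3.
pose u := y v i4 *: e i4 + y v i5 *: e i5 + y v i6 *: e i6.
have def_v : v = u + s.
  apply: cone_coord_inj; apply: ord7_ind;
  by rewrite !cone_coordD !cone_coordZ !cone_coord_basis
             ?(mulr0, mulr1, addr0, add0r).
have sS : s \in <<eS>>%VS.
  by rewrite !memvD ?memvZ ?memv_span // !inE eqxx ?orbT.
have uV : u \in <<eV>>%VS.
  by rewrite !memvD ?memvZ ?memv_span // !inE eqxx ?orbT.
have [Q QV uQ] : exists2 Q : point K 6, on Q cone_vertex & u \in val Q.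
  (* A zero vertex part spans no point; any point of the vertex then serves. *)
  have [u0|nz_u] := eqVneq u 0.
    exists (mkpoint (cone_basis_neq0 i4)); last by rewrite u0 mem0v.
    by rewrite /on /= -memvE memv_span // !inE eqxx.
  by exists (mkpoint nz_u); rewrite ?memv_line // /on /= -memvE.
have [S [SS qS sS']] : exists S : point K 6,
    [/\ on S cone_base, quadric cone_mx S & s \in val S].
  (* Likewise for a zero base part, with [e i0], which lies on the quadric. *)
  have [s0|nz_s] := eqVneq s 0.
    exists (mkpoint (cone_basis_neq0 i0)); split; last by rewrite s0 mem0v.
      by rewrite /on /= -memvE memv_span // !inE eqxx.
    apply/(@quadric_vline _ _ _ (mkpoint (cone_basis_neq0 i0)) _ erefl).
    by rewrite qform_cone_mx !cone_coord_basis /= mulr0 mul0r addr0.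
  exists (mkpoint nz_s); split; rewrite ?memv_line //.
  apply/(@quadric_vline _ _ _ (mkpoint nz_s) _ erefl).
  rewrite qform_cone_mx -qv !cone_coordD !cone_coordZ !cone_coord_basis /=.
  by rewrite !(mulr0, mulr1, addr0, add0r).
by exists Q, S; split=> //; rewrite Rv -memvE def_v memv_add.
Qed.

End HyperbolicCone.

(** * Coordinates in the plane *)

Lemma line_eq (K : fieldType) (n : nat) (P Q : point K n) (l m : line K n) :
  P <> Q -> on P l -> on Q l -> on P m -> on Q m -> l = m.
Proof.
move=> neqPQ.
suff span_PQ (k : line K n) : on P k -> on Q k -> (val P + val Q)%VS = val k.
  by move=> Pl Ql Pm Qm; apply: val_inj; rewrite -!span_PQ.
move=> Pk Qk; apply/eqP.
rewrite eqEdim subv_add [(_ <= _)%VS]Pk [(_ <= _)%VS]Qk.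
rewrite (eqP (valP k)) /= ltnNge; apply/negP => dimPQ; apply: neqPQ.
have eqPQ (R : point K n) : (val R <= val P + val Q)%VS ->
    val R = (val P + val Q)%VS.
  by move=> sR; apply/eqP; rewrite eqEdim sR (eqP (valP R)).
apply: val_inj; apply: etrans (eqPQ P (addvSl _ _)) _.
by apply/esym/eqPQ/addvSr.
Qed.

Definition row3 (K : fieldType) (a b c : K) : 'rV[K]_3 :=
  \row_i nth 0 [:: a; b; c] i.

Lemma row3P (K : fieldType) (v : 'rV[K]_3) :
  exists a b c, v = row3 a b c.
Proof.
exists (v 0 0), (v 0 1), (v 0 2%:R); apply/rowP => i; rewrite mxE.
by case: i => [[|[|[|//]]] lti] /=; congr (v _ _); apply/val_inj.
Qed.

Lemma row3_inj (K : fieldType) (a b c a' b' c' : K) :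
  row3 a b c = row3 a' b' c' -> [/\ a = a', b = b' & c = c'].
Proof.
move/rowP => e; split;
by [have := e 0; rewrite !mxE | have := e 1; rewrite !mxE
   | have := e 2%:R; rewrite !mxE].
Qed.

Lemma row3Z (K : fieldType) (k a b c : K) :
  k *: row3 a b c = row3 (k * a) (k * b) (k * c).
Proof.
by apply/rowP => i; rewrite !mxE; case: i => [[|[|[|//]]] lti].
Qed.

Lemma row3_eq0 (K : fieldType) (a b c : K) :
  (row3 a b c == 0) = [&& a == 0, b == 0 & c == 0].
Proof.
have row30 : row3 0 0 0 = 0 :> 'rV[K]_3.
  by rewrite -[RHS](scale0r (row3 0 0 0)) row3Z !mul0r.
apply/eqP/and3P => [|[/eqP-> /eqP-> /eqP->]] //.
by rewrite -row30 => /row3_inj[-> -> ->].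
Qed.

(* The cross product of the two vectors is nonzero. *)
Definition nonprop (K : fieldType) (a b c a' b' c' : K) : bool :=
  [|| a * b' != b * a', a * c' != c * a' | b * c' != c * b'].

Lemma nonprop_neq0 (K : fieldType) (a b c a' b' c' : K) :
  nonprop a b c a' b' c' ->
  [|| a != 0, b != 0 | c != 0] /\ [|| a' != 0, b' != 0 | c' != 0].
Proof.
move=> np; split; apply: contraTT np; rewrite !negb_or !negbK;
by case/and3P=> /eqP-> /eqP-> /eqP->; rewrite /nonprop ?(mul0r, mulr0) eqxx.
Qed.

Lemma row3_prop (K : fieldType) (a b c a' b' c' : K) :
  row3 a b c != 0 -> ~~ nonprop a b c a' b' c' ->
  exists k, row3 a' b' c' = k *: row3 a b c.
Proof.
rewrite !negb_or !negbK => nz /and3P[/eqP e1 /eqP e2 /eqP e3].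
have div (p p' v v' : K) : p != 0 -> p * v' = v * p' -> v' = p' / p * v.
  by move=> nzp e; apply: (mulfI nzp); rewrite e; field.
move: nz; rewrite row3_eq0 !negb_and => /or3P[] nz.
- by exists (a' / a); rewrite row3Z; congr row3; apply: div.
- by exists (b' / b); rewrite row3Z; congr row3; apply: div.
- by exists (c' / c); rewrite row3Z; congr row3; apply: div.
Qed.

Section Frame.

Variables (K : fieldType) (M : 'M[K]_3).
Hypothesis unitM : M \in unitmx.

Definition has_coords (P : point K 2) (a b c : K) : Prop :=
  val P = <[row3 a b c *m M]>%VS.

Definition has_dual_coords (l : line K 2) (x y z : K) : Prop :=
  forall P a b c, has_coords P a b c ->
    (on P l <-> a * x + b * y + c * z = 0).

Lemma coordsP (P : point K 2) : exists a b c, has_coords P a b c.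
Proof.
have [v nz_v Pv] := pointP P; have [a [b [c e]]] := row3P (v *m invmx M).
by exists a, b, c; rewrite /has_coords -e mulmxKV.
Qed.

Lemma point_of_coords (a b c : K) : [|| a != 0, b != 0 | c != 0] ->
  exists P : point K 2, has_coords P a b c.
Proof.
move=> nz; have nzv : row3 a b c *m M != 0.
  apply: contraTneq nz => /(congr1 (mulmx^~ (invmx M))).
  rewrite mulmxK // mul0mx => /eqP; rewrite row3_eq0.
  by case/and3P=> /eqP-> /eqP-> /eqP->; rewrite eqxx.
by exists (mkpoint nzv).
Qed.

Lemma nonprop_neq (P P' : point K 2) a b c a' b' c' :
  has_coords P a b c -> has_coords P' a' b' c' -> nonprop a b c a' b' c' ->
  P <> P'.
Proof.
move=> Pc Pc' np eqP; move: np.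
have : row3 a' b' c' *m M \in val P by rewrite eqP Pc' memv_line.
rewrite Pc => /vlineP[k]; rewrite scalemxAl => /(can_inj (mulmxK unitM)).
rewrite row3Z => /row3_inj[-> -> ->]; rewrite /nonprop.
have comm u v : u * (k * v) = v * (k * u) by ring.
by rewrite (comm a b) (comm a c) (comm b c) !eqxx.
Qed.

Lemma neq_nonprop (P P' : point K 2) a b c a' b' c' :
  has_coords P a b c -> has_coords P' a' b' c' -> P <> P' ->
  nonprop a b c a' b' c'.
Proof.
move=> Pc Pc' neqP; apply: contra_notT neqP => np.
have nz : row3 a b c != 0.
  have := eqP (valP P); rewrite Pc dim_vline => h.
  by apply/eqP => r0; rewrite r0 mul0mx eqxx in h.
have [k ek] := row3_prop nz np.
apply/esym/val_inj/eqP; rewrite eqEdim (eqP (valP P)) (eqP (valP P')) andbT.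
by rewrite Pc' Pc ek -scalemxAl -memvE memvZ ?memv_line.
Qed.

(** The line is the kernel of a nonzero linear form on a space of dimension 3. The factor [invmx M]
    in the column [c] converts vectors to frame coordinates. *)
Lemma line_of_dual_coords (x y z : K) : [|| x != 0, y != 0 | z != 0] ->
  exists l : line K 2, has_dual_coords l x y z.
Proof.
move=> nz; pose c := invmx M *m (row3 x y z)^T.
pose f := linfun (mulmxr c : 'rV[K]_3 -> 'rV[K]_1).
have fE a b d : f (row3 a b d *m M) = (a * x + b * y + d * z)%:M.
  rewrite lfunE /= /c mulmxA mulmxK //; apply/rowP => i; rewrite !ord1 !mxE.
  by rewrite !big_ord_recl big_ord0 !mxE /= addr0 addrA.
have nz_c : limg f != 0%VS.
  have [u nzu] : exists u, f u != 0.
    have s1 (k : K) : k != 0 -> (k%:M : 'rV[K]_1) != 0.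
      by move=> nzk; rewrite -scalemx1 scaler_eq0 (negPf nzk) oner_eq0.
    case/or3P: nz => /s1 nz.
    - by exists (row3 1 0 0 *m M); rewrite fE !mul0r !addr0 mul1r.
    - by exists (row3 0 1 0 *m M); rewrite fE !mul0r add0r addr0 mul1r.
    - by exists (row3 0 0 1 *m M); rewrite fE !mul0r !add0r mul1r.
  by apply: contraNneq nzu => f0; rewrite -memv0 -f0 memv_img ?memvf.
have dimf : \dim (limg f) = 1%N.
  apply/eqP; rewrite eqn_leq lt0n dimv_eq0 nz_c andbT.
  by apply: leq_trans (dimvS (subvf _)) _; rewrite dimvf.
have dimk : \dim (lker f) == 2%N.
  have := limg_ker_dim f fullv.
  by rewrite capfv dimf dimvf addn1 => -[->].
exists (exist _ (lker f) dimk) => P a b d Pc.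
rewrite /on Pc -memvE /= memv_ker fE -scalemx1 scaler_eq0 oner_eq0 orbF.
by split=> /eqP.
Qed.

End Frame.

(** * Fixed points and fixed lines *)

(** The degree of F(x) divides 3, so an irrational [x] generates L, and every [z] is a polynomial in
    [x] over F; such polynomials are reached by sums and products alone. *)
Lemma subring_degree3 (F : fieldType) (L : fieldExtType F) (S : L -> Prop) x :
    \dim {:L} = 3%N -> (forall a : F, S a%:A) ->
    (forall u v, S u -> S v -> S (u + v)) ->
    (forall u v, S u -> S v -> S (u * v)) ->
  S x -> (exists a : F, x = a%:A) \/ (forall z, S z).
Proof.
move=> dimL SF SD SM Sx.
have [/vlineP[a ->]|x1] := boolP (x \in 1%VS); [by left; exists a | right => z].
have z_in : z \in <<1; x>>%VS.
  suff -> : <<1; x>>%VS = {:L}%VS by rewrite memvf.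
  apply/eqP; rewrite eqEdim subvf dimL /=.
  have : (\dim <<1; x>>%VS %| 3)%N by rewrite -dimL; apply/field_dimS/subvf.
  rewrite dvdn_divisors // !inE => /orP[/eqP dim1|/eqP->] //.
  case/negP: x1; suff -> : 1%VS = <<1; x>>%VS :> {vspace L}.
    exact: memv_adjoin.
  by apply/eqP; rewrite eqEdim dim1 dimv1 leqnn andbT subv_adjoin.
rewrite -(Fadjoin_poly_eq z_in) horner_coef.
elim/big_ind: _ => [|u v|i _].
- by rewrite -(scale0r 1); apply: SF.
- exact: (SD).
apply: (SM); last first.
  elim: (val i) => [|n IHn]; last by rewrite exprS; apply: (SM).
  by rewrite expr0 -(scale1r 1); apply: SF.
have /polyOverP/(_ i)/vlineP[a ->] := Fadjoin_polyOver 1%AS x z.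
exact: SF.
Qed.

Section FixedElements.

Variables (F : fieldType) (L : fieldExtType F) (M : 'M[L]_3).
Variables (phi : point L 2 -> point L 2).
Hypotheses (unitM : M \in unitmx) (dimL : \dim {:L} = 3%N).
Hypotheses (phi_coll : collineation phi) (phi_neq1 : ~ (forall P, phi P = P)).

Definition fixed_line (l : line L 2) : Prop := forall P, on P l -> on (phi P) l.

(* Vacuous at (0, 0, 0), which represents no point. *)
Definition fixed_at (a b c : L) : Prop :=
  forall P, has_coords M P a b c -> phi P = P.

Definition fixed_dual_at (x y z : L) : Prop :=
  exists2 l, has_dual_coords M l x y z & fixed_line l.

Hypothesis fixF : forall a b c : F, fixed_at a%:A b%:A c%:A.

(** The image line contains the fixed points P and Q too, hence is [l] itself. *)
Lemma fixed_line_join (P Q : point L 2) (l : line L 2) :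
  P <> Q -> phi P = P -> phi Q = Q -> on P l -> on Q l -> fixed_line l.
Proof.
move=> neqPQ fP fQ Pl Ql; have [_ /(_ l)[m lm]] := phi_coll.
have eq_lm : l = m.
  by apply: (line_eq neqPQ) => //; [rewrite -fP|rewrite -fQ]; apply/lm.
by move=> R /lm; rewrite -eq_lm.
Qed.

(** Both lines contain P and [phi P]; were these distinct, the lines would coincide. *)
Lemma fixed_point_meet (P : point L 2) (l m : line L 2) :
  l <> m -> fixed_line l -> fixed_line m -> on P l -> on P m -> phi P = P.
Proof.
move=> neq_lm fl fm Pl Pm; apply/eqP/negPn/negP => /eqP neqP; apply: neq_lm.
by apply: (line_eq neqP) => //; [apply: fl | apply: fm].
Qed.

Lemma fixed_join (a b c a' b' c' x y z : L) :
  fixed_at a b c -> fixed_at a' b' c' -> nonprop a b c a' b' c' ->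
  [|| x != 0, y != 0 | z != 0] ->
  a * x + b * y + c * z = 0 -> a' * x + b' * y + c' * z = 0 ->
  fixed_dual_at x y z.
Proof.
move=> fP fQ np /(line_of_dual_coords unitM)[l lc] Px Qx; exists l => //.
have [/(point_of_coords unitM)[P Pc] /(point_of_coords unitM)[Q Qc]] :=
  nonprop_neq0 np.
apply: (@fixed_line_join P Q);
  [exact: (nonprop_neq unitM Pc Qc np) | exact: fP | exact: fQ
  | exact/(lc _ _ _ _ Pc) | exact/(lc _ _ _ _ Qc)].
Qed.

(** On a common line, every triple orthogonal to (x, y, z) is orthogonal to (x', y', z'). The
    triples (-y, x, 0), (-z, 0, x) and (0, -z, y) then show that all minors vanish. *)
Lemma nonprop_line_neq (x y z x' y' z' : L) l l' :
  has_dual_coords M l x y z -> has_dual_coords M l' x' y' z' ->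
  nonprop x y z x' y' z' -> l <> l'.
Proof.
move=> lc lc' np eql; rewrite -eql in lc'.
have test a b c : a * x + b * y + c * z = 0 -> a * x' + b * y' + c * z' = 0.
  move=> lx; have [|/negPf nz] := boolP [|| a != 0, b != 0 | c != 0].
    case/(point_of_coords unitM)=> P Pc.
    by apply/(lc' _ _ _ _ Pc)/(lc _ _ _ _ Pc).
  move: nz; rewrite -[LHS]negbK !negb_or !negbK.
  by move=> /negPn/and3P[/eqP-> /eqP-> /eqP->]; rewrite !mul0r !addr0.
move: np; rewrite /nonprop.
have -> : x * y' = y * x'.
  by apply/eqP; rewrite -subr_eq0; apply/eqP;
     rewrite -(test (- y) x 0); ring.
have -> : x * z' = z * x'.
  by apply/eqP; rewrite -subr_eq0; apply/eqP;
     rewrite -(test (- z) 0 x); ring.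
have -> : y * z' = z * y'.
  by apply/eqP; rewrite -subr_eq0; apply/eqP;
     rewrite -(test 0 (- z) y); ring.
by rewrite !eqxx.
Qed.

Lemma fixed_meet (x y z x' y' z' a b c : L) :
  fixed_dual_at x y z -> fixed_dual_at x' y' z' -> nonprop x y z x' y' z' ->
  a * x + b * y + c * z = 0 -> a * x' + b * y' + c * z' = 0 ->
  fixed_at a b c.
Proof.
move=> [l lc fl] [m mc fm] np Px Px' P Pc.
apply: (@fixed_point_meet P l m) => //.
  exact: (nonprop_line_neq lc mc np).
  exact/(lc _ _ _ _ Pc).
exact/(mc _ _ _ _ Pc).
Qed.

(** A line over F joins two distinct points over F; which two are convenient depends on the
    coordinate known to be nonzero. *)
Lemma fixed_dualF (f g h : F) : [|| f != 0, g != 0 | h != 0] ->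
  fixed_dual_at f%:A g%:A h%:A.
Proof.
have nzA (k : F) : k != 0 -> k%:A != 0 :> L.
  by move=> nzk; rewrite scaler_eq0 negb_or nzk oner_neq0.
case/or3P=> nz; have nz' := nzA _ nz.
- apply: (fixed_join (@fixF (- g) f 0) (@fixF (- h) 0 f));
  rewrite /nonprop ?nz' ?orbT // ?scaleNr ?scale0r; try ring.
  by rewrite !(mul0r, mulr0) (mulf_neq0 nz' nz') !orbT.
- apply: (fixed_join (@fixF (- g) f 0) (@fixF 0 (- h) g));
  rewrite /nonprop ?nz' ?orbT // ?scaleNr ?scale0r; try ring.
  by rewrite !(mul0r, mulr0) (mulf_neq0 _ nz') ?oppr_eq0 ?orbT.
- apply: (fixed_join (@fixF (- h) 0 f) (@fixF 0 (- h) g));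
  rewrite /nonprop ?nz' ?orbT // ?scaleNr ?scale0r; try ring.
  by rewrite !(mul0r, mulr0) mulrNN (mulf_neq0 nz' nz').
Qed.

(** The minors that occur below are 1 or -1; squaring hides the sign, so that [ring] can check
    them. *)
Lemma nonprop1 (a b c a' b' c' : L) :
  [\/ (a * b' - b * a') ^+ 2 = 1, (a * c' - c * a') ^+ 2 = 1
    | (b * c' - c * b') ^+ 2 = 1] -> nonprop a b c a' b' c'.
Proof.
rewrite /nonprop -!(subr_eq0 (_ * _)) => np; apply/or3P.
by case: np => e1; [apply: Or31 | apply: Or32 | apply: Or33];
  rewrite -sqrf_eq0 e1 oner_neq0.
Qed.

Lemma fixed100 : fixed_at 1 0 0.
Proof. by have := @fixF 1 0 0; rewrite scale1r scale0r. Qed.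

Lemma fixed010 : fixed_at 0 1 0.
Proof. by have := @fixF 0 1 0; rewrite scale1r scale0r. Qed.

Lemma fixed001 : fixed_at 0 0 1.
Proof. by have := @fixF 0 0 1; rewrite scale1r scale0r. Qed.

Lemma fixed_dual100 : fixed_dual_at 1 0 0.
Proof.
by have := @fixed_dualF 1 0 0; rewrite scale1r scale0r oner_neq0; apply.
Qed.

Lemma fixed_dual010 : fixed_dual_at 0 1 0.
Proof.
by have := @fixed_dualF 0 1 0; rewrite scale1r scale0r oner_neq0 orbT; apply.
Qed.

Lemma fixed_dual001 : fixed_dual_at 0 0 1.
Proof.
by have := @fixed_dualF 0 0 1; rewrite scale1r scale0r oner_neq0 !orbT; apply.
Qed.

Lemma fixed_dual_diag : fixed_dual_at 0 1 (-1).
Proof.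
have := @fixed_dualF 0 1 (-1).
by rewrite scaleN1r scale1r scale0r oner_neq0 !orbT; apply.
Qed.

(** Discharges the side conditions of [fixed_join] and [fixed_meet]: a nonzero triple, an incidence,
    or a minor equal to 1 or -1. *)
Ltac coord_side := first
  [ by rewrite ?oppr_eq0 ?oner_neq0 ?orbT
  | by ring
  | by apply: nonprop1;
       first [by apply: Or31; ring | by apply: Or32; ring
             | by apply: Or33; ring]].

Definition fixed_coord (x : L) : Prop := fixed_at 1 x 0.

(* In the affine coordinates (1, X, Y), the lines X = x and Y = y have dual
   coordinates (x, -1, 0) and (y, 0, -1). *)
Lemma vertical_of_fixed x y : fixed_at 1 x y -> fixed_dual_at x (-1) 0.
Proof. by move=> fx; apply: (fixed_join fx fixed001); coord_side. Qed.

Lemma horizontal_of_fixed x y : fixed_at 1 x y -> fixed_dual_at y 0 (-1).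
Proof. by move=> fx; apply: (fixed_join fx fixed010); coord_side. Qed.

(** The line X = x meets the axis Y = 0 in (x, 0). *)
Lemma fixed_coord_of_vertical x : fixed_dual_at x (-1) 0 -> fixed_coord x.
Proof. by move=> fx; apply: (fixed_meet fx fixed_dual001); coord_side. Qed.

(** The lines X = x and Y = x meet on the diagonal X = Y, which is fixed. So one of them is fixed as
    soon as the other is. *)
Lemma horizontal_of_vertical x :
  fixed_dual_at x (-1) 0 -> fixed_dual_at x 0 (-1).
Proof.
move=> fx; apply: (@horizontal_of_fixed x).
by apply: (fixed_meet fx fixed_dual_diag); coord_side.
Qed.

Lemma vertical_of_horizontal x :
  fixed_dual_at x 0 (-1) -> fixed_dual_at x (-1) 0.
Proof.
move=> fx; apply: (@vertical_of_fixed _ x).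
by apply: (fixed_meet fx fixed_dual_diag); coord_side.
Qed.

Lemma fixed_coord_of_horizontal x : fixed_dual_at x 0 (-1) -> fixed_coord x.
Proof. by move=> fx; apply/fixed_coord_of_vertical/vertical_of_horizontal. Qed.

Lemma fixed_affine x y : fixed_coord x -> fixed_coord y -> fixed_at 1 x y.
Proof.
move=> /vertical_of_fixed fx /vertical_of_fixed/horizontal_of_vertical fy.
by apply: (fixed_meet fx fy); coord_side.
Qed.

Lemma fixed_coordF (a : F) : fixed_coord a%:A.
Proof. by have := @fixF 1 a 0; rewrite scale1r scale0r. Qed.

(* The line X + Y = x + y joins (x, y) to a rational point at infinity. *)
Lemma fixed_coordD x y : fixed_coord x -> fixed_coord y -> fixed_coord (x + y).
Proof.
move=> fx fy; have fxy := fixed_affine fx fy.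
have fd : fixed_at 0 1 (-1).
  by have := @fixF 0 1 (-1); rewrite scaleN1r scale0r scale1r.
have fl : fixed_dual_at (x + y) (-1) (-1).
  by apply: (fixed_join fxy fd); coord_side.
by apply: (fixed_meet fl fixed_dual001); coord_side.
Qed.

Lemma fixed_coord1 : fixed_coord 1.
Proof. by rewrite -(scale1r 1); apply: fixed_coordF. Qed.

(* The line Y = y X joins the origin to (1, y). *)
Lemma fixed_coordM x y : fixed_coord x -> fixed_coord y -> fixed_coord (x * y).
Proof.
move=> /vertical_of_fixed fx fy; have f1y := fixed_affine fixed_coord1 fy.
have fl : fixed_dual_at 0 y (-1).
  by apply: (fixed_join fixed100 f1y); coord_side.
apply/fixed_coord_of_horizontal/(@horizontal_of_fixed x).
by apply: (fixed_meet fx fl); coord_side.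
Qed.

Lemma fixed_at_scale k a b c :
  k != 0 -> fixed_at a b c -> fixed_at (k * a) (k * b) (k * c).
Proof.
move=> nzk fP P Pc; apply: fP; rewrite /has_coords Pc -row3Z -scalemxAl.
exact: vlineZ.
Qed.

(** Otherwise every element of L is a fixed coordinate. Then all points (1, X, Y) are fixed, and so
    are those with first coordinate 0, against [phi_neq1]. *)
Lemma fixed_coord_rational x : fixed_coord x -> exists a : F, x = a%:A.
Proof.
move=> fx.
have [//|fixK] :=
  subring_degree3 dimL fixed_coordF fixed_coordD fixed_coordM fx.
case: phi_neq1 => P; have [a [b [c Pc]]] := coordsP unitM P.
suff : fixed_at a b c by apply.
have [a0|nza] := eqVneq a 0; last first.
  have := fixed_at_scale nza (fixed_affine (fixK (b / a)) (fixK (c / a))).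
  by rewrite mulr1 ![a * (_ / a)]mulrC !divfK.
have [b0|nzb] := eqVneq b 0.
  have [c0|nzc] := eqVneq c 0.
    by have := @fixF 0 0 0; rewrite scale0r a0 b0 c0.
  by have := fixed_at_scale nzc fixed001; rewrite !mulr0 mulr1 a0 b0.
(* The point (0, b, c) is where the line Y = (c / b) X meets the line of first coordinate 0. *)
have f1 : fixed_at 1 1 (c / b) by apply: fixed_affine.
have fl : fixed_dual_at 0 (c / b) (-1).
  by apply: (fixed_join fixed100 f1); coord_side.
by apply: (fixed_meet fl fixed_dual100); rewrite ?a0;
  [coord_side | field | ring].
Qed.

(** A fixed line meets the sides of the coordinate triangle in fixed points, and their rationality
    makes the ratios of the dual coordinates rational. The conclusion says this through the equation
    of the line, up to a scalar. *)
Lemma fixed_dual_rational x y z : fixed_dual_at x y z ->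
  [|| x != 0, y != 0 | z != 0] ->
  exists f g h : F, [|| f != 0, g != 0 | h != 0] /\
    forall a b c, a * x + b * y + c * z = 0 ->
      a * f%:A + b * g%:A + c * h%:A = 0.
Proof.
(* The join of (1, 0, 0) and (0, u, 1) is the line X = u Y, which meets Y = 1 in (u, 1). *)
have rat0 u : fixed_at 0 u 1 -> exists k : F, u = k%:A.
  move=> fu; apply/fixed_coord_rational/fixed_coord_of_vertical.
  apply: (@vertical_of_fixed _ 1).
  have fl : fixed_dual_at 0 1 (- u).
    by apply: (fixed_join fixed100 fu); coord_side.
  apply: (fixed_meet fl (horizontal_of_fixed (fixed_affine fixed_coord1
    fixed_coord1))); coord_side.
move=> fl; have [x0|nzx] := eqVneq x 0.
  have [y0|nzy] := eqVneq y 0 => /= nzz.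
    exists 0, 0, 1; rewrite oner_neq0 !orbT; split=> // a b c.
    rewrite x0 y0 !mulr0 !scale0r !mulr0 !add0r scale1r mulr1 => /eqP.
    by rewrite mulf_eq0 (negPf nzz) orbF => /eqP.
  have [|k ek] := rat0 (- z / y).
    apply: (fixed_meet fl fixed_dual100); last by ring.
      by rewrite /nonprop !mulr0 mulr1 (eq_sym 0 y) nzy.
    by rewrite x0; field.
  exists 0, 1, (- k); rewrite oner_neq0 /= ?orbT; split=> // a b c.
  rewrite x0 scale0r scale1r scaleNr -ek => e; apply: (mulIf nzy).
  by rewrite mul0r -[RHS]e; field.
(* With [x] nonzero, the line meets the two axes in (-x / y, 0) and (0, -x / z), when these exist;
   inverting gives the ratios y / x and z / x. *)
have rat u : u = 0 \/ fixed_coord (- x / u) -> exists k : F, u / x = k%:A.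
  have [->|nzu] := eqVneq u 0.
    by move=> _; exists 0; rewrite mul0r scale0r.
  case=> [u0|/fixed_coord_rational[k ek]]; first by rewrite u0 eqxx in nzu.
  exists (- k^-1); rewrite scaleNr -[_%:A]/(in_alg L _) fmorphV /= -ek.
  by field; rewrite ?oppr_eq0 ?nzu ?nzx.
have [|g eg] := rat y.
  have [|nzy] := eqVneq y 0; [by left | right].
  apply: (fixed_meet fl fixed_dual001); [| by field | by ring].
  by rewrite /nonprop !mulr0 !mulr1 nzy !orbT.
have [|h eh] := rat z.
  have [|nzz] := eqVneq z 0; [by left | right].
  apply/fixed_coord_of_horizontal/(@horizontal_of_fixed 0).
  apply: (fixed_meet fl fixed_dual010); [| by field | by ring].
  by rewrite /nonprop !mulr0 !mulr1 (eq_sym 0 z) nzz !orbT.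
exists 1, g, h; rewrite oner_neq0; split=> // a b c e.
by apply: (mulIf nzx); rewrite mul0r scale1r -eg -eh -[RHS]e; field.
Qed.

Hypothesis phi3 : forall P, phi (phi (phi P)) = P.

Lemma fixed_affine_rational (P : point L 2) a b :
  has_coords M P 1 a b -> phi P = P ->
  (exists f : F, a = f%:A) /\ (exists g : F, b = g%:A).
Proof.
move=> Pc fP; have f1 : fixed_at 1 a b.
  by move=> Q Qc; have -> : Q = P by apply: val_inj; rewrite Qc Pc.
split; apply: fixed_coord_rational.
  exact/fixed_coord_of_vertical/(vertical_of_fixed f1).
exact/fixed_coord_of_horizontal/(horizontal_of_fixed f1).
Qed.

(** A dependence over F puts P on a line over F, which is fixed and so contains the orbit.
    Conversely, a fixed P has rational coordinates, and the line of a collinear orbit is fixed,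
    hence rational. *)
Lemma collinear_orbitP (P : point L 2) a b : has_coords M P 1 a b ->
  (phi P = P \/ type_II phi P) <->
  exists f g h : F, [|| f != 0, g != 0 | h != 0] /\
    f%:A + a * g%:A + b * h%:A = 0.
Proof.
move=> Pc; split; last first.
  case=> f [g [h [nz e]]]; have [l lc fl] := fixed_dualF nz.
  have Pl : on P l by apply/(lc _ _ _ _ Pc); rewrite mul1r.
  have [|/eqP neqP] := eqVneq (phi P) P; [by left | right].
  have [/bij_inj phi_inj _] := phi_coll.
  split.
  - by move/esym.
  - by move=> e2; apply: neqP; rewrite -{2}(phi3 P) -e2.
  - by move/phi_inj/esym.
  - by exists l; split; do ?apply: (fl).
case=> [/(fixed_affine_rational Pc)[[f ->] _]|[neqP _ neqP1 [m [Pm P1m P2m]]]].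
  exists (- f), 1, 0; rewrite oner_neq0 orbT; split=> //.
  by rewrite scale1r scale0r scaleNr; ring.
(* The image of [m] shares with [m] the distinct points [phi P] and [phi (phi P)]. *)
have fm : fixed_line m.
  have [_ /(_ m)[m' mm']] := phi_coll.
  have eqm : m = m'.
    by apply: (line_eq neqP1) => //; apply/mm'.
  by move=> R /mm'; rewrite -eqm.
have [a1 [b1 [c1 P1c]]] := coordsP unitM (phi P).
(* The dual coordinates of the join of P and [phi P], as a cross product. *)
pose x := a * c1 - b * b1; pose y := b * a1 - c1; pose z := b1 - a * a1.
have nz : [|| x != 0, y != 0 | z != 0].
  have := neq_nonprop Pc P1c neqP; rewrite /nonprop !mul1r.
  rewrite /x /y /z !subr_eq0 (eq_sym (b * a1)).
  by case/or3P=> ->; rewrite ?orbT.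
have [l lc] := line_of_dual_coords unitM nz.
have eq_lm : l = m.
  apply: (line_eq neqP) => //.
    by apply/(lc _ _ _ _ Pc); rewrite /x /y /z; ring.
  by apply/(lc _ _ _ _ P1c); rewrite /x /y /z; ring.
have fxyz : fixed_dual_at x y z by exists l => //; rewrite eq_lm.
have [f [g [h [nzf e]]]] := fixed_dual_rational fxyz nz.
exists f, g, h; split=> //; have := e 1 a b; rewrite !mul1r; apply.
by rewrite /x /y /z; ring.
Qed.

End FixedElements.

(** * A frame adapted to the line at infinity *)

(** In the rank factorisation of a nonzero column, the right factor is a nonzero scalar and the
    middle one is the first unit column. *)
Lemma unitmx_send_to_delta (K : fieldType) (n : nat) (u : 'cV[K]_n.+1) :
  u != 0 -> exists2 G : 'M[K]_n.+1, G \in unitmx & G *m u = delta_mx 0 0.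
Proof.
move=> nzu; have rk : \rank u = 1%N.
  by apply/eqP; rewrite eqn_leq rank_leq_col lt0n mxrank_eq0.
pose r := row_ebase u 0 0.
have rE : row_ebase u = r%:M by rewrite [LHS]mx11_scalar.
have nzr : r != 0.
  have := row_ebase_unit u; rewrite unitmxE rE det_scalar1 unitfE.
  exact.
have pid : pid_mx (\rank u) = delta_mx 0 0 :> 'M[K]_(n.+1, 1).
  by apply/matrixP => i j; rewrite rk !mxE !ord1 andbT; case: i => [[|i] lti].
exists (r^-1 *: invmx (col_ebase u)).
  by rewrite unitmxZ ?unitfE ?invr_eq0 // unitmx_inv col_ebase_unit.
rewrite -scalemxAl -{2}(mulmx_ebase u) -!mulmxA mulKmx ?col_ebase_unit //.
by rewrite pid rE mul_mx_scalar scalerA mulVf // scale1r.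
Qed.

Lemma map_row3 (F : fieldType) (L : fieldExtType F) (a b c : F) :
  map_mx (in_alg L) (row3 a b c) = row3 a%:A b%:A c%:A.
Proof.
by apply/rowP => i; rewrite !mxE; case: i => [[|[|[|//]]] lti].
Qed.

(** The last column of a frame holds the dual coordinates of the line at infinity. Two points of the
    subplane on that line force the column to be a multiple [l] of a vector over F. Rescaling by the
    inverse of [l] and a base change over F bring it to (1, 0, 0) and preserve the subplane. *)
Lemma subplane_normal_frame (F : finFieldType) (L : fieldExtType F)
    (B : point L 2 -> Prop) :
  subplane B -> line_type_I B (hyper_inf L 1) ->
  exists M : 'M[L]_3, [/\ M \in unitmx, col ord_max M = delta_mx 0 0 &
    forall P, B P <->
      exists2 w : 'rV[F]_3, w != 0 & val P = <[map_mx (in_alg L) w *m M]>%VS].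
Proof.
move=> [M unitM BM] [s [uniq_s size_s sP]].
have [P1 [P2 [P1s P2s neqP]]] :
    exists P1 P2, [/\ P1 \in s, P2 \in s & P1 <> P2].
  have Fgt0 : (0 < #|F|)%N by apply/card_gt0P; exists 0.
  case: s uniq_s size_s {sP} => [|P1 [|P2 s]] /=; rewrite ?inE.
  - by [].
  - by move=> _ [e]; rewrite -e in Fgt0.
  case/andP; rewrite negb_or => /andP[/eqP neqP _] _ _.
  by exists P1, P2; rewrite !inE !eqxx orbT.
have coordsB P : P \in s -> exists a b c : F,
    has_coords M P a%:A b%:A c%:A /\
    (row3 a%:A b%:A c%:A *m M) 0 ord_max = 0 :> L.
  case/sP => /BM[w _ Pw]; have [a [b [c ew]]] := row3P w.
  rewrite /on Pw -memvE /= mem_hyper_inf ew map_row3 => /eqP e.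
  by exists a, b, c; rewrite /has_coords Pw ew map_row3.
have [a [b [c [P1c P1inf]]]] := coordsB _ P1s.
have [a' [b' [c' [P2c P2inf]]]] := coordsB _ P2s.
have np := neq_nonprop P1c P2c neqP.
(* The cross product of the two rational points at infinity. *)
pose n0 := b * c' - c * b'; pose n1 := c * a' - a * c'.
pose n2 := a * b' - b * a'.
have AM (u v : F) : u%:A * v%:A = (u * v)%:A :> L.
  by rewrite -scalerAl mul1r scalerA.
have nzn : row3 n0 n1 n2 != 0.
  apply: contraTneq np => /eqP; rewrite row3_eq0 !subr_eq0.
  case/and3P=> /eqP e0 /eqP e1 /eqP e2; rewrite /nonprop !negb_or !negbK.
  by rewrite !AM e2 e0 -e1 !eqxx.
have [m0 [m1 [m2 em]]] := row3P (col ord_max M)^T.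
have dot x y z : (row3 x y z *m M) 0 ord_max = x * m0 + y * m1 + z * m2.
  have mE i : M i ord_max = (row3 m0 m1 m2) 0 i by rewrite -em !mxE.
  by rewrite mxE !big_ord_recl big_ord0 !mE !mxE /= addr0 addrA.
rewrite !dot in P1inf P2inf.
have [l el] : exists l, row3 m0 m1 m2 = l *: row3 n0%:A n1%:A n2%:A.
  apply: row3_prop.
    have := nzn; rewrite !row3_eq0; apply: contra.
    by rewrite !scaler_eq0 oner_eq0 !orbF.
  (* Each minor of the last column against the cross product is a combination of [D1] and [D2],
     which vanish because both points are at infinity. *)
  pose D1 := a%:A * m0 + b%:A * m1 + c%:A * m2.
  pose D2 := a'%:A * m0 + b'%:A * m1 + c'%:A * m2.
  rewrite /nonprop !negb_or !negbK.
  apply/and3P; split; rewrite -subr_eq0 !scalerBl -!AM; apply/eqP.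
  - transitivity (c'%:A * D1 - c%:A * D2); first by rewrite /D1 /D2; ring.
    by rewrite [D1]P1inf [D2]P2inf !mulr0 subr0.
  - transitivity (b%:A * D2 - b'%:A * D1); first by rewrite /D1 /D2; ring.
    by rewrite [D1]P1inf [D2]P2inf !mulr0 subr0.
  - transitivity (a'%:A * D1 - a%:A * D2); first by rewrite /D1 /D2; ring.
    by rewrite [D1]P1inf [D2]P2inf !mulr0 subr0.
have colM : col ord_max M = l *: map_mx (in_alg L) (row3 n0 n1 n2)^T.
  by rewrite -map_trmx map_row3 -[LHS]trmxK em el linearZ.
have nzl : l != 0.
  apply/eqP => l0; move: colM; rewrite l0 scale0r colE.
  move/(congr1 (mulmx (invmx M))); rewrite mulKmx // mulmx0.
  by move/matrixP/(_ ord_max 0)/eqP; rewrite !mxE !eqxx oner_eq0.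
have nznT : (row3 n0 n1 n2)^T != 0 by rewrite trmx_eq0.
have [G unitG Gn] := unitmx_send_to_delta nznT.
have unitG' : map_mx (in_alg L) G \in unitmx by rewrite map_unitmx.
exists (l^-1 *: (map_mx (in_alg L) G *m M)); split.
- by rewrite unitmxZ ?unitfE ?invr_eq0 // unitmx_mul unitG'.
- rewrite linearZ /= colE -mulmxA -colE colM -scalemxAr scalerA mulVf //.
  by rewrite scale1r -map_mxM Gn map_delta_mx.
move=> P; rewrite BM; split=> -[w nzw ->].
  exists (w *m invmx G).
    apply: contraNneq nzw => /(congr1 (mulmx^~ G)).
    by rewrite mulmxKV // mul0mx => ->.
  rewrite -scalemxAr vlineZ ?invr_eq0 // mulmxA -map_mxM mulmxKV //.
exists (w *m G).
  apply: contraNneq nzw => /(congr1 (mulmx^~ (invmx G))).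
  by rewrite mulmxK // mul0mx => ->.
by rewrite -scalemxAr vlineZ ?invr_eq0 // mulmxA -map_mxM.
Qed.

(** * Bruck-Bose coordinates *)

Lemma mx_of_linear (K : fieldType) (m n : nat) (f : 'rV[K]_m -> 'rV[K]_n) :
  linear f -> exists T : 'M[K]_(m, n), forall v, v *m T = f v.
Proof.
move=> lin_f.
pose g : {linear 'rV[K]_m -> 'rV[K]_n} :=
  HB.pack f (GRing.isLinear.Build K _ _ _ f lin_f).
by exists (lin1_mx g) => v; rewrite mul_rV_lin1.
Qed.

Lemma aff_vec_last (K : fieldType) (v : 'rV[K]_(3 + 3)) :
  (aff_vec v : 'rV[K]_7) 0 ord_max = 1.
Proof.
have -> : ord_max = rshift (3 + 3) (0 : 'I_1) :> 'I_7 by apply/val_inj.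
by apply: etrans (row_mxEr _ _ _ _) _; rewrite mxE.
Qed.

Lemma aff_vec_row3 (K : fieldType) (x y : K) :
  aff_vec (row_mx x%:M y%:M : 'rV[K]_(1 + 1)) = row3 x y 1.
Proof.
apply/rowP => i; rewrite [RHS]mxE; case: i => [[|[|[|//]]] lti] /=.
- have -> : Ordinal lti = lshift 1 (lshift 1 0) by apply/val_inj.
  by rewrite !row_mxEl mxE.
- have -> : Ordinal lti = lshift 1 (rshift 1 0) by apply/val_inj.
  by rewrite row_mxEl row_mxEr mxE.
- have -> : Ordinal lti = rshift (1 + 1) 0 by apply/val_inj.
  by rewrite row_mxEr mxE.
Qed.

Section BruckBose.

Variables (F : fieldType) (L : fieldExtType F) (tau : L) (M : 'M[L]_3).
Hypothesis tau_basis : basis_of {:L} [:: 1; tau; tau ^+ 2].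
Hypotheses (unitM : M \in unitmx) (colM : col ord_max M = delta_mx 0 0).

Local Notation basis3 := [tuple 1; tau; tau ^+ 2].
Local Notation cf i x := (coord basis3 (inord i) x).

Lemma tau_coordE (x : L) :
  x = (cf 0 x)%:A + cf 1 x *: tau + cf 2 x *: tau ^+ 2.
Proof.
have /(coord_basis tau_basis) {1}-> := memvf x.
by rewrite !big_ord_recl big_ord0 addr0 addrA /=; do 2?congr (_ + _);
   congr (coord _ _ _ *: _); apply/val_inj; rewrite /= inordK.
Qed.

Lemma tau_coord_inj (x y : L) : cf 0 x = cf 0 y -> cf 1 x = cf 1 y ->
  cf 2 x = cf 2 y -> x = y.
Proof. by move=> e0 e1 e2; rewrite (tau_coordE x) (tau_coordE y) e0 e1 e2. Qed.

Lemma tau_coord_scalar i (k : F) :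
  (i < 3)%N -> cf i (k%:A : L) = k *+ (i == 0%N).
Proof.
move=> lti; rewrite linearZ /=.
have := coord_free (inord 0) (inord i) (basis_free tau_basis).
rewrite /= inordK //= => ->.
by rewrite -val_eqE /= !inordK // (eq_sym 0%N) mulr_natr.
Qed.

Lemma tau_coord_rational (x : L) :
  (exists k : F, x = k%:A) <-> cf 1 x = 0 /\ cf 2 x = 0.
Proof.
split=> [[k ->]|[e1 e2]]; first by rewrite !tau_coord_scalar.
by exists (cf 0 x); rewrite {1}[x]tau_coordE e1 e2 !scale0r !addr0.
Qed.

(** The coefficient [f] is free to cancel the constant coordinate, so only the coordinates along tau
    and tau^2 matter: a 2 by 2 homogeneous system in (g, h), with this determinant. *)
Lemma dependent_iff_minor (a b : L) :
  (exists f g h : F, [|| f != 0, g != 0 | h != 0] /\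
     f%:A + a * g%:A + b * h%:A = 0) <->
  cf 1 a * cf 2 b - cf 1 b * cf 2 a = 0.
Proof.
have expand f g h : f%:A + a * g%:A + b * h%:A = f%:A + g *: a + h *: b :> L.
  by rewrite -!scalerAr !mulr1.
have cfE f g h i : (i < 3)%N -> cf i (f%:A + g *: a + h *: b) =
    f *+ (i == 0%N) + g * cf i a + h * cf i b.
  by move=> lti; rewrite -(tau_coord_scalar _ lti) !linearD !linearZ.
split=> [[f [g [h [nz]]]]|minor0].
  rewrite expand => e.
  have ei i : (i < 3)%N -> f *+ (i == 0%N) + g * cf i a + h * cf i b = 0.
    by move=> lti; rewrite -cfE // e linear0.
  have e1 := ei 1%N isT; have e2 := ei 2%N isT; rewrite /= !add0r in e1 e2.
  have [g0|nzg] := eqVneq g 0; last first.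
    apply: (mulfI nzg); rewrite mulr0.
    transitivity ((g * cf 1 a + h * cf 1 b) * cf 2 b
                  - cf 1 b * (g * cf 2 a + h * cf 2 b)); first by ring.
    by rewrite e1 e2 mul0r mulr0 subr0.
  have [h0|nzh] := eqVneq h 0; last first.
    apply: (mulfI nzh); rewrite mulr0.
    transitivity (cf 1 a * (g * cf 2 a + h * cf 2 b)
                  - (g * cf 1 a + h * cf 1 b) * cf 2 a); first by ring.
    by rewrite e1 e2 mul0r mulr0 subr0.
  move: nz (ei 0%N isT); rewrite g0 h0 eqxx !mul0r !addr0 /= orbF => /eqP nzf.
  by rewrite mulr1n => /nzf.
have sol g h : (g != 0) || (h != 0) -> g * cf 1 a + h * cf 1 b = 0 ->
    g * cf 2 a + h * cf 2 b = 0 -> exists f g h : F,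
    [|| f != 0, g != 0 | h != 0] /\ f%:A + a * g%:A + b * h%:A = 0.
  move=> nz e1 e2; exists (- (g * cf 0 a + h * cf 0 b)), g, h.
  rewrite nz orbT expand; split=> //.
  apply: tau_coord_inj; rewrite cfE // linear0 ?mulr0n ?add0r //.
  by rewrite mulr1n -addrA addNr.
(* A nonzero row of the system gives the solution orthogonal to it; if both rows vanish, (1, 0) is a
   solution. *)
have [e1|nz1] := boolP ((cf 1 b == 0) && (cf 1 a == 0)); last first.
  apply: (sol (cf 1 b) (- cf 1 a)).
  - by rewrite oppr_eq0 -negb_and.
  - by ring.
  - by rewrite -[RHS]oppr0 -minor0; ring.
case/andP: e1 => /eqP b1 /eqP a1.
have [e2|nz2] := boolP ((cf 2 b == 0) && (cf 2 a == 0)); last first.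
  apply: (sol (cf 2 b) (- cf 2 a)).
  - by rewrite oppr_eq0 -negb_and.
  - by rewrite a1 b1 !mulr0 addr0.
  - by ring.
case/andP: e2 => /eqP b2 /eqP a2.
by apply: (sol 1 0); rewrite ?oner_neq0 // ?a1 ?a2 ?b1 ?b2 !mulr0 addr0.
Qed.

Definition of_theta (X : 'rV[F]_3) : L := \sum_i X 0 i *: basis3`_i.

Lemma theta_of_theta X : theta tau (of_theta X) = X.
Proof.
by apply/rowP => i; rewrite mxE coord_sum_free // (basis_free tau_basis).
Qed.

Lemma of_theta_theta x : of_theta (theta tau x) = x.
Proof.
have /(coord_basis tau_basis) {2}-> := memvf x.
by apply: eq_bigr => i _; rewrite mxE.
Qed.

Lemma of_theta_linear k X Y :
  of_theta (k *: X + Y) = k *: of_theta X + of_theta Y.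
Proof.
rewrite /of_theta scaler_sumr -big_split; apply: eq_bigr => i _.
by rewrite !mxE scalerDl scalerA.
Qed.

(* The homogeneous coordinates, in the frame [M], of the point of PG(2, L)
   that [v] represents. *)
Definition frame_coords (v : 'rV[F]_(3 + 3 + 1)) : 'rV[L]_3 :=
  row3 (of_theta (lsubmx (lsubmx v))) (of_theta (rsubmx (lsubmx v)))
       (v 0 ord_max)%:A *m invmx M.

Lemma frame_coords_linear k u v :
  frame_coords (k *: u + v) = k%:A *: frame_coords u + frame_coords v.
Proof.
rewrite /frame_coords scalemxAl -mulmxDl; congr (_ *m _).
rewrite row3Z !linearP !of_theta_linear.
by apply/rowP => i; rewrite !mxE; case: i => [[|[|[|//]]] lti] /=;
  rewrite -!scalerAl !mul1r // scalerDl scalerA.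
Qed.

(** Multiplying [frame_coords v] by M gives back a triple ending in the last entry of [v], and the
    last column of M picks out the first frame coordinate. *)
Lemma frame_coords0 v : frame_coords v 0 0 = (v 0 ord_max)%:A.
Proof.
set w := frame_coords v.
have : (w *m col ord_max M) 0 0 = (v 0 ord_max)%:A.
  by rewrite colE mulmxA -colE /w /frame_coords mulmxKV // !mxE.
rewrite colM mxE (bigD1 0) //= big1 ?addr0 ?mxE ?mulr1 // => i nz.
by rewrite [delta_mx _ _ _ _]mxE (negPf nz) mulr0.
Qed.

(* As the last column of [M] is (1, 0, 0), an affine point has frame
   coordinates (1, a, b) with a = fa v and b = fb v. *)
Local Notation fa v := (frame_coords v 0 1).
Local Notation fb v := (frame_coords v 0 2%:R).

(** The order and the sign turn y0 y1 + y2 y3 into a1 b2 - b1 a2, while a0, b0 and t become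
    coordinates on the vertex. *)
Definition cone_coords (v : 'rV[F]_7) : 'rV[F]_7 :=
  \row_i nth 0 [:: cf 1 (fa v); cf 2 (fb v); cf 1 (fb v); - cf 2 (fa v);
                  cf 0 (fa v); cf 0 (fb v); v 0 ord_max] i.

Lemma frame_coords_linear_entry k u v j :
  frame_coords (k *: u + v) 0 j = k *: frame_coords u 0 j + frame_coords v 0 j.
Proof.
rewrite frame_coords_linear; move: (frame_coords u) (frame_coords v) => x y.
by rewrite !mxE -scalerAl mul1r.
Qed.

Lemma cone_coordsE v i : cone_coords v 0 i =
  nth 0 [:: cf 1 (fa v); cf 2 (fb v); cf 1 (fb v); - cf 2 (fa v);
            cf 0 (fa v); cf 0 (fb v); v 0 ord_max] i.
Proof. by rewrite mxE. Qed.

Lemma cone_coords_linear : linear cone_coords.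
Proof.
move=> k u v; apply/rowP => i.
have cfP j (x z : L) : cf j (k *: x + z) = k * cf j x + cf j z.
  by rewrite linearD linearZ.
have tE : (k *: u + v) 0 ord_max = k * u 0 ord_max + v 0 ord_max.
  by rewrite !mxE.
rewrite [RHS]mxE [X in _ = X + _]mxE !cone_coordsE.
rewrite !(frame_coords_linear_entry k u v) !cfP tE.
by case: i => [[|[|[|[|[|[|[|//]]]]]]] lti] //=; rewrite opprD mulrN.
Qed.

Lemma frame_coordsE v : frame_coords v = row3 (v 0 ord_max)%:A (fa v) (fb v).
Proof.
apply/rowP => i; rewrite [RHS]mxE.
case: i => [[|[|[|//]]] lti] /=; rewrite -?frame_coords0;
by congr (frame_coords v _ _); apply/val_inj.
Qed.

(** The seven values determine all frame coordinates, and M is invertible. *)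
Lemma cone_coords_ker (v : 'rV[F]_(3 + 3 + 1)) : cone_coords v = 0 -> v = 0.
Proof.
move=> v0; have vi i : nth 0 [:: cf 1 (fa v); cf 2 (fb v); cf 1 (fb v);
    - cf 2 (fa v); cf 0 (fa v); cf 0 (fb v); v 0 ord_max] i = 0 :> F.
  have [lti|] := ltnP i 7; last by move=> ?; rewrite nth_default.
  have := congr1 (fun u : 'rV[F]_7 => u 0 (Ordinal lti)) v0.
  by rewrite cone_coordsE => ->; rewrite mxE.
have a0 : fa v = 0.
  apply: tau_coord_inj; rewrite linear0; [exact: (vi 4%N) | exact: (vi 0%N) |].
  by apply/eqP; rewrite -oppr_eq0; apply/eqP; apply: (vi 3%N).
have b0 : fb v = 0.
  by apply: tau_coord_inj; rewrite linear0; [exact: (vi 5%N) | exact: (vi 2%N)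
    | exact: (vi 1%N)].
have t0 : v 0 ord_max = 0 := vi 6%N.
have : frame_coords v = 0.
  by rewrite frame_coordsE a0 b0 t0 scale0r; apply/eqP; rewrite row3_eq0 eqxx.
move/(congr1 (mulmx^~ M)); rewrite mulmxKV // mul0mx => /eqP.
rewrite row3_eq0 => /and3P[/eqP X0 /eqP Y0 _].
have th0 : theta tau (0 : L) = 0 by apply/rowP => i; rewrite !mxE linear0.
rewrite -[v]hsubmxK -[lsubmx v]hsubmxK.
rewrite -(theta_of_theta (lsubmx (lsubmx v))) X0.
rewrite -(theta_of_theta (rsubmx (lsubmx v))) Y0 th0 row_mx0.
suff -> : rsubmx (v : 'rV[F]_(3 + 3 + 1)) = 0 by rewrite row_mx0.
apply/rowP => i; rewrite !mxE ord1 -[RHS]t0; congr (v _ _).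
by apply/val_inj.
Qed.

Lemma has_frame_coords x y (v := aff_vec (row_mx (theta tau x) (theta tau y))) :
  has_coords M (aff_point x y) 1 (fa v) (fb v).
Proof.
have vmax : v 0 ord_max = 1.
  exact: aff_vec_last.
rewrite /has_coords; have -> : row3 1 (fa v) (fb v) = frame_coords v.
  by rewrite [RHS]frame_coordsE vmax scale1r.
rewrite /frame_coords mulmxKV // vmax /v /aff_vec.
rewrite row_mxKl row_mxKl row_mxKr !of_theta_theta scale1r /=.
by rewrite aff_vec_row3.
Qed.

Lemma affine_bbP (R : point F 6) :
  affine R <-> exists x y, R = bb_point tau x y.
Proof.
have affE v : val R = <[v]>%VS -> affine R <-> v 0 ord_max != 0.
  move=> Rv; rewrite /affine /on Rv -memvE /= mem_hyper_inf.
  by split=> /negP.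
split=> [affR|[x [y def_R]]]; last first.
  apply/(affE (aff_vec (row_mx (theta tau x) (theta tau y)))).
    by rewrite def_R.
  by rewrite aff_vec_last oner_neq0.
have [u nzu Ru] := pointP R; have /(affE _ Ru) nzt := affR.
pose v : 'rV[F]_(3 + 3 + 1) := (u 0 ord_max)^-1 *: u.
have vmax : v 0 ord_max = 1 by rewrite mxE mulVf.
exists (of_theta (lsubmx (lsubmx v))), (of_theta (rsubmx (lsubmx v))).
apply: val_inj; rewrite Ru /= !theta_of_theta hsubmxK.
have -> : aff_vec (lsubmx v) = v.
  rewrite /aff_vec -[RHS]hsubmxK; congr row_mx; apply/rowP => i.
  rewrite [LHS]mxE [RHS]mxE ord1 /= -vmax; congr (v _ _); exact/val_inj.
by rewrite vlineZ ?invr_eq0.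
Qed.

End BruckBose.

(** * The quadric of I-points and II-points *)

Theorem theorem25 (F : finFieldType) (L : fieldExtType F) (tau : L)
    (B : point L 2 -> Prop) (phi : point L 2 -> point L 2)
    (q_gt2 : (2 < #|F|)%N)
    (dimL : \dim {:L} = 3%N)
    (tau_basis : basis_of {:L} [:: 1; tau; tau ^+ 2])
    (B_subplane : subplane B)
    (phi_coll : collineation phi)
    (phi_order3 : order3 phi)
    (phi_fix : forall P, B P -> phi P = P)
    (linf_type_I : line_type_I B (hyper_inf L 1)) :
  (exists pi : plane F 6, represents_subplane tau B pi) /\
  (forall pi_fix : plane F 6, represents_subplane tau B pi_fix ->
    exists (A : 'M[F]_7) (S : solid F 6),
      (forall R : point F 6,
        (bb_image tau (type_I B) R \/ bb_image tau (type_II phi) R) <->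
        (affine R /\ quadric A R)) /\
      [/\ degenerate A,
          has_vertex A pi_fix,
          disjoint_flats S pi_fix,
          nonsingular_hyperbolic A S
        & forall R : point F 6,
            quadric A R <-> cone pi_fix (fun T => on T S /\ quadric A T) R]).
Proof.
have [phi3 phi_neq1] := phi_order3.
have [M [unitM colM BM]] := subplane_normal_frame B_subplane linf_type_I.
have fixF (a b c : F) : fixed_at M phi a%:A b%:A c%:A.
  move=> P Pc; apply: phi_fix; apply/BM; exists (row3 a b c).
    apply: contraTneq (valP P) => w0.
    by rewrite Pc -map_row3 w0 map_mx0 mul0mx dim_vline eqxx.
  by rewrite map_row3.
have [T TE] := mx_of_linear (cone_coords_linear tau M).
have unitT : T \in unitmx.
  rewrite -row_free_unit; apply: inj_row_free => v.
  by rewrite TE => /(cone_coords_ker tau_basis unitM colM).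
have fixB P a b : has_coords M P 1 a b ->
    B P <-> (exists f : F, a = f%:A) /\ (exists g : F, b = g%:A).
  move=> Pc; split=> [/phi_fix|[[f ef] [g eg]]].
    exact: (fixed_affine_rational unitM dimL phi_coll phi_neq1 fixF Pc).
  apply/BM; exists (row3 1 f g); first by rewrite row3_eq0 oner_eq0.
  by rewrite map_row3 scale1r -ef -eg.
have vertexP x y : on (bb_point tau x y) (cone_vertex unitT) <->
    B (aff_point x y).
  have Pc := has_frame_coords tau_basis unitM colM x y.
  rewrite (fixB _ _ _ Pc) !(tau_coord_rational tau_basis) /on -memvE /=.
  rewrite mem_cone_vertex //.
  rewrite !TE !cone_coordsE /= oppr_eq0; split.
    by case/and4P=> /eqP-> /eqP-> /eqP-> /eqP->.
  by case=> [[-> ->] [-> ->]]; rewrite eqxx.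
(* Type I or II means fixed or with collinear orbit, that is, 1, a, b dependent over F, that is, a
   vanishing minor, which is the form of the cone. *)
have quadricP x y : quadric (cone_mx T) (bb_point tau x y) <->
    B (aff_point x y) \/ type_II phi (aff_point x y).
  have Pc := has_frame_coords tau_basis unitM colM x y.
  have -> : B (aff_point x y) \/ type_II phi (aff_point x y) <->
      phi (aff_point x y) = aff_point x y \/ type_II phi (aff_point x y).
    split=> -[]; [by left; apply: phi_fix | by right | | by right].
    move=> fP; left; apply/(fixB _ _ _ Pc).
    exact: (fixed_affine_rational unitM dimL phi_coll phi_neq1 fixF Pc).
  rewrite (collinear_orbitP unitM dimL phi_coll phi_neq1 fixF phi3 Pc).
  rewrite (dependent_iff_minor tau_basis).
  rewrite (@quadric_vline _ _ _ (bb_point tau x y) _ erefl) qform_cone_mx.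
  by rewrite !TE !cone_coordsE /= mulrN.
have vertex_repr : represents_subplane tau B (cone_vertex unitT).
  move=> R; split=> [[/(affine_bbP tau_basis)[x [y ->]]]|[x [y [-> BP]]]].
    by move/vertexP => BP; exists x, y.
  by split; [apply/(affine_bbP tau_basis); exists x, y | apply/vertexP].
split; first by exists (cone_vertex unitT).
move=> pi_fix pi_repr.
(* Both planes have the same affine points, and there is one: coordinate 6 is the last entry of a
   vector, so the basis vector of index 6 is affine. *)
have <- : cone_vertex unitT = pi_fix.
  apply: flat_eq_affine => [|P]; last by rewrite vertex_repr pi_repr.
  exists (mkpoint (cone_basis_neq0 unitT (@Ordinal 7 6 isT))); split.
    rewrite /affine /on /= -memvE mem_hyper_inf; apply/negP.
    have := cone_coord_basis unitT (@Ordinal 7 6 isT) (@Ordinal 7 6 isT).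
    by rewrite TE cone_coordsE /= => ->; rewrite oner_eq0.
  by rewrite /on /= -memvE memv_span // !inE eqxx ?orbT.
exists (cone_mx T), (cone_base unitT); split.
  move=> R; split.
    have aff x y : affine (bb_point tau x y).
      by apply/(affine_bbP tau_basis); exists x, y.
    by case=> -[x [y [-> PR]]]; split=> //; apply/quadricP; [left | right].
  case=> /(affine_bbP tau_basis)[x [y ->]] /quadricP[] PR.
    by left; exists x, y.
  by right; exists x, y.
split.
- exact: cone_degenerate.
- exact: cone_has_vertex.
- exact: cone_disjoint.
- exact: cone_base_hyperbolic.
- exact: quadric_coneP.
Qed.
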